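(* Let $H\subset\mathbb{R}^d$ be a full lattice, let $\Lambda\subset\mathbb{R}^d$ be its dual lattice, and let $k$ be a positive integer. Let $\Omega\subset\mathbb{R}^d$ be a measurable set of finite measure. If $L^2(\Omega)$ admits a frame of the form $E(H;a_1,\dots,a_k)$ for some $a_1,\dots,a_k\in\mathbb{R}^d$, then there exists $\ell\le k$ such that $\Omega$ $\ell$-subtiles $\mathbb{R}^d$ by translations on $\Lambda$.
   Context: A full lattice in $\mathbb{R}^d$ is a set of the form $M\mathbb{Z}^d$ with $M$ an invertible real $d\times d$ matrix. The dual lattice of $H$ is $\Lambda=\{\lambda\in\mathbb{R}^d:\langle h,\lambda\rangle\in\mathbb{Z}\text{ for all }h\in H\}$ (and then $H$ is the dual lattice of $\Lambda$). If $\Lambda=M\mathbb{Z}^d$, its fundamental domain is $D=M[0,1)^d$. For a positive integer $\ell$, a measurable set $\Omega$ of finite measure $\ell$-subtiles (submulti-tiles at level $\ell$) $\mathbb{R}^d$ by translations on $\Lambda$ if $\sum_{\lambda\in\Lambda}\chi_\Omega(\omega+\lambda)\le\ell$ for almost every $\omega\in D$. $E(H;a_1,\dots,a_k)$ is the system of functions $\omega\mapsto e^{2\pi i(a_j+h)\cdot\omega}$ (restricted to $\Omega$), regarded as a family indexed by $h\in H$, $j=1,\dots,k$. A countable family $\{f_\gamma\}_{\gamma\in\Gamma}$ in $L^2(\Omega)$ is a frame of $L^2(\Omega)$ if there are constants $A,B>0$ with $A\|f\|^2\le\sum_{\gamma}|\langle f,f_\gamma\rangle|^2\le B\|f\|^2$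 for all $f\in L^2(\Omega)$. *)

(* Defs.v *)
From HB Require Import structures.
From mathcomp Require Import all_boot all_order all_algebra.
From mathcomp Require Import complex.
From mathcomp Require Import all_classical all_reals all_analysis.

Set Implicit Arguments.
Unset Strict Implicit.
Unset Printing Implicit Defensive.
Import Order.TTheory GRing.Theory Num.Theory.
Import numFieldNormedType.Exports.

Local Open Scope classical_set_scope.
Local Open Scope ring_scope.

(* The library provides Lebesgue measure on R only.  Points of R^d are column
   vectors; the measure is Caratheodory's restriction of the usual outer
   measure (countable covers by half-open boxes) to its measurable sets, that
   is, to all Lebesgue measurable sets and not only the Borel ones. *)

Section LebesgueRd.
Variables (R : realType) (d : nat).
Local Notation V := 'cV[R]_d.

Definition box (ab : V * V) : set V :=
  [set x | forall i, ab.1 i 0 <= x i 0 < ab.2 i 0].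

Definition box_volume (ab : V * V) : R :=
  \prod_(i < d) Num.max 0 (ab.2 i 0 - ab.1 i 0).

Definition box_covers (X : set V) : set (set (V * V)) :=
  [set C | countable C /\ X `<=` \bigcup_(ab in C) box ab].

Definition lebesgue_outer (X : set V) : \bar R :=
  ereal_inf [set \esum_(ab in C) (box_volume ab)%:E | C in box_covers X].

Lemma box_volume_ge0 ab : (0 <= (box_volume ab)%:E)%E.
Proof. by rewrite lee_fin prodr_ge0// => i _; rewrite le_max lexx. Qed.
Local Hint Resolve box_volume_ge0 : core.

Lemma lebesgue_outer_ge0 X : (0 <= lebesgue_outer X)%E.
Proof.
by apply: le_ereal_inf_tmp => _ [C _ <-]; apply: esum_ge0.
Qed.
Local Hint Resolve lebesgue_outer_ge0 : core.

Lemma lebesgue_outer0 : lebesgue_outer set0 = 0%E.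
Proof.
apply/eqP; rewrite eq_le lebesgue_outer_ge0 andbT.
apply: ereal_inf_lbound; exists set0; last by rewrite esum_set0.
by split; [exact: countable0|exact: sub0set].
Qed.

Lemma le_lebesgue_outer :
  {homo lebesgue_outer : A B / A `<=` B >-> (A <= B)%E}.
Proof.
move=> A B AB; apply/ereal_inf_le_tmp => _ [C [cC BC] <-].
by exists C => //; split => //; exact: subset_trans AB BC.
Qed.

Lemma lebesgue_outer_sigma_subadditive : sigma_subadditive lebesgue_outer.
Proof.
move=> F; have [[i ioo]|] := pselect (exists i, lebesgue_outer (F i) = +oo%E).
  rewrite (eseries_pinfty _ _ ioo) ?leey// => n _.
  by rewrite -ltNye (lt_le_trans _ (lebesgue_outer_ge0 _)).
rewrite -forallNE => Foo.
suff add2e (e : {posnum R}) : (lebesgue_outer (\bigcup_n F n) <=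
    \sum_(0 <= i <oo) lebesgue_outer (F i) + e%:num%:E)%E.
  by apply/lee_addgt0Pr => _/posnumP[].
rewrite (le_trans _ (epsilon_trick _ _ _))//.
pose P n (C : set (V * V)) := box_covers (F n) C /\
  (\esum_(ab in C) (box_volume ab)%:E <=
    lebesgue_outer (F n) + (e%:num / (2 ^ n.+1)%:R)%:E)%E.
have [G PG] : {G : nat -> set (V * V) & forall n, P n (G n)}.
  apply: (@choice _ _ P) => n.
  have en1 : 0 < e%:num / (2 ^ n.+1)%:R by [].
  have fin : lebesgue_outer (F n) \is a fin_num.
    by rewrite ge0_fin_numE// ltey; apply/eqP; exact: Foo.
  have [_ [C FC <-] /ltW] := lb_ereal_inf_adherent en1 fin.
  by exists C.
apply: (@le_trans _ _ (\esum_(ab in \bigcup_n G n) (box_volume ab)%:E)%E).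
  apply: ereal_inf_lbound; exists (\bigcup_n G n) => //; split.
    by apply: bigcup_countable => // n _; exact: (PG n).1.1.
  move=> x [n _ /(PG n).1.2[ab Gab abx]].
  by exists ab => //; exists n.
rewrite seqDU_bigcup_eq (nneseries_sum_bigcup (@trivIset_seqDU _ _))//.
apply: lee_nneseries => n _; first by move=> _; exact: esum_ge0.
apply: le_trans (PG n).2.
rewrite esum_mkcond [leRHS]esum_mkcond; apply: le_esum => ab _.
case: ifPn => [abG|_]; last by case: ifPn.
by rewrite mem_set//; apply: subset_seqDU; exact: set_mem abG.
Qed.

HB.instance Definition _ := isOuterMeasure.Build R V lebesgue_outer
  lebesgue_outer0 lebesgue_outer_ge0 le_lebesgue_outer
  lebesgue_outer_sigma_subadditive.

Definition lebesgueRd : set (caratheodory_type lebesgue_outer) -> \bar R :=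
  lebesgue_outer.

HB.instance Definition _ := Measure.copy lebesgueRd
  (OuterMeasure.sort (lebesgue_outer : {outer_measure set V -> \bar R})
    : set (caratheodory_type lebesgue_outer) -> \bar R).

Definition Rd_measurable : set (set V) := lebesgue_outer.-cara.-measurable.

End LebesgueRd.

Arguments lebesgue_outer : clear implicits.
Arguments lebesgueRd : clear implicits.

Section Lattices.
Variables (R : realType) (d : nat).
Local Notation V := 'cV[R]_d.

Definition dot (x y : V) : R := \sum_(i < d) x i 0 * y i 0.

Definition lattice_of (M : 'M[R]_d) : set V :=
  [set M *m map_mx intr z | z in [set: 'cV[int]_d]].

Definition full_lattice (H : set V) : Prop :=
  exists2 M : 'M[R]_d, M \in unitmx & H = lattice_of M.

Definition dual_lattice (H : set V) : set V :=
  [set l | forall h, H h -> dot h l \is a Num.int].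

Definition fundamental_domain (M : 'M[R]_d) : set V :=
  [set M *m t | t in [set t : V | forall i, 0 <= t i 0 < 1]].

(* The fundamental domain depends on the chosen basis of Lambda; the
   inequality is required for every choice. *)
Definition subtiles (l : nat) (Lambda Omega : set V) : Prop :=
  [/\ full_lattice Lambda, Rd_measurable Omega,
      (lebesgueRd R d Omega < +oo)%E &
      forall M : 'M[R]_d, M \in unitmx -> Lambda = lattice_of M ->
        {ae lebesgueRd R d, forall w : V, fundamental_domain M w ->
          (\esum_(v in Lambda) (\1_Omega (w + v) : R)%:E <= (l%:R)%:E)%E}].

End Lattices.

Section Frames.
Variables (R : realType) (d : nat).
Local Notation V := 'cV[R]_d.
Local Notation T := (caratheodory_type (lebesgue_outer R d)).
Local Notation C := R[i].
Local Notation mu := (lebesgueRd R d).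

Definition sqnorm (Omega : set V) (f : V -> C) : \bar R :=
  (\int[mu]_(x in (Omega : set T)) (Normc.normc (f x) ^+ 2)%:E)%E.

Definition square_integrable (Omega : set V) (f : V -> C) : Prop :=
  [/\ measurable_fun (Omega : set T) ((fun x => complex.Re (f x)) : T -> R),
      measurable_fun (Omega : set T) ((fun x => complex.Im (f x)) : T -> R) &
      (sqnorm Omega f < +oo)%E].

Definition cintegral (Omega : set V) (f : V -> C) : C :=
  Complex (\int[mu]_(x in (Omega : set T)) complex.Re (f x))
          (\int[mu]_(x in (Omega : set T)) complex.Im (f x)).

Definition inner (Omega : set V) (f g : V -> C) : C :=
  cintegral Omega (fun x => f x * conjc (g x)).

Definition is_frame (Omega : set V) (I : choiceType) (G : set I)
    (phi : I -> V -> C) : Prop :=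
  [/\ countable G,
      (forall g, G g -> square_integrable Omega (phi g)) &
      exists A B : R, [/\ 0 < A, 0 < B &
        forall f, square_integrable Omega f ->
          (A%:E * sqnorm Omega f <=
             \esum_(g in G) (Normc.normc (inner Omega f (phi g)) ^+ 2)%:E <=
           B%:E * sqnorm Omega f)%E]].

Definition expi (t : R) : C := Complex (cos t) (sin t).

Definition exp_system (k : nat) (a : 'I_k -> V) (hj : V * 'I_k) (w : V) : C :=
  expi (2 * pi * dot (a hj.2 + hj.1) w).

(* E(H; a_1, ..., a_k) is a frame of L^2(Omega); as a family indexed by (h, j),
   coinciding exponentials are counted with multiplicity. *)
Definition exp_frame (Omega H : set V) (k : nat) (a : 'I_k -> V) : Prop :=
  is_frame Omega (H `*` [set: 'I_k]) (exp_system a).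

End Frames.

(* Main.v *)
Require Import Defs.
From mathcomp Require Import all_boot all_order all_algebra.
From mathcomp Require Import complex.
From mathcomp Require Import all_classical all_reals all_analysis.
From mathcomp Require Import measurable_realfun.
From mathcomp Require Import ring lra.

(** Take l = k.  Suppose more than k translates of Omega by the dual lattice
    cover a set of positive measure.  Countability of the lattice gives a set F
    of positive measure and k + 1 distinct dual lattice vectors l_i with
    F + l_i contained in Omega; shrinking F makes the F + l_i disjoint.
    Since <h, l_i> is an integer, f = sum_i c_i 1_(F + l_i) is orthogonal to
    every exponential of the system as soon as
    sum_i c_i conj(e^(2 pi i <a_j, l_i>)) = 0 for the k indices j.  This linear
    system has k + 1 unknowns, hence a nonzero solution c, and the resulting
    nonzero f contradicts the lower frame bound. *)

Set Implicit Arguments.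
Unset Strict Implicit.
Unset Printing Implicit Defensive.
Import Order.TTheory GRing.Theory Num.Theory.
Import numFieldNormedType.Exports.

Local Open Scope classical_set_scope.
Local Open Scope ring_scope.

(** * Sums over sets and integrals under a change of variables *)

Lemma subset_esum (R : realType) (T : choiceType) (A B : set T)
    (f : T -> \bar R) :
  A `<=` B -> (forall x, (0 <= f x)%E) ->
  (\esum_(x in A) f x <= \esum_(x in B) f x)%E.
Proof.
move=> AB f0; rewrite esum_mkcond [leRHS]esum_mkcond; apply: le_esum => x _.
case: ifPn => [/set_mem/AB xB|_]; first by rewrite mem_set.
by case: ifPn.
Qed.

(** Choosing one preimage [h y] of each value gives an injective section, so the left side is a
    partial sum of the right side. Injectivity of [g] cannot be assumed: distinct boxes may become
    equal after being cut. *)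
Lemma esum_image_le (R : realType) (T T' : choiceType) (A : set T)
    (g : T -> T') (f : T' -> \bar R) :
  (forall x, (0 <= f x)%E) ->
  (\esum_(y in g @` A) f y <= \esum_(x in A) f (g x))%E.
Proof.
move=> f0.
have [[x0 _]|/forallNP A0] := pselect (exists x, A x); last first.
  have -> : g @` A = set0 by apply/seteqP; split => // y [x /A0].
  by rewrite esum_set0; apply: esum_ge0.
pose h y := xget x0 [set x | A x /\ g x = y].
have hP y : (g @` A) y -> A (h y) /\ g (h y) = y.
  by move=> [x Ax gx]; rewrite /h; case: xgetP => [z _ //|/(_ x) []].
rewrite -(@eq_esum _ _ (g @` A) (fun y => f (g (h y)))); last first.
  by move=> y /hP [_ ->].
rewrite -(@reindex_esum _ _ _ (g @` A) (h @` (g @` A)) h (fun x => f (g x))).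
  by apply: subset_esum => // _ [y /hP[Ah _] <-].
split => [||] //.
by move=> x y /set_mem/hP[_ {2}<-] /set_mem/hP[_ {2}<-] ->.
Qed.

(** The pushforward of [mu] under [phi] agrees with [mu] on measurable sets. *)
Lemma Rintegral_measure_preserving (R : realType) dd (T : measurableType dd)
    (mu : {measure set T -> \bar R}) (phi : T -> T) (X : set T) (f : T -> R) :
  measurable_fun setT phi ->
  (forall A, measurable A -> mu (phi @^-1` A) = mu A) ->
  measurable X -> measurable_fun setT f ->
  mu.-integrable (phi @^-1` X) (EFin \o (f \o phi)) ->
  \int[mu]_(x in X) f x = \int[mu]_(x in phi @^-1` X) f (phi x).
Proof.
move=> mphi phimu mX mf intf; congr fine.
rewrite -(@integral_pushforward _ _ _ _ _ _ mphi mu X (EFin \o f)) //.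
  by apply: eq_measure_integral => A mA _; rewrite -phimu.
exact/measurable_EFinP.
Qed.

(** * Lebesgue measure on R^d: translation invariance and measurable boxes *)

Section lebesgueRd_theory.
Variables (R : realType) (d : nat).
Local Notation V := 'cV[R]_d.
Local Notation T := (caratheodory_type (lebesgue_outer R d)).
Local Notation mu := (lebesgueRd R d).

(** Lets a cover be altered box by box: volumes are still summed over the old index set [C], even if
    [g] identifies boxes. *)
Lemma lebesgue_outer_le_boxes (X : set V) (C : set (V * V))
    (g : V * V -> V * V) :
  countable C -> X `<=` \bigcup_(ab in C) box (g ab) ->
  (lebesgue_outer R d X <= \esum_(ab in C) (box_volume (g ab))%:E)%E.
Proof.
move=> cC XC.
apply: le_trans (esum_image_le C g (fun ab => box_volume_ge0 ab)).
apply: ereal_inf_lbound; exists (g @` C) => //; split.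
  exact: card_le_trans (card_image_le _ _) cC.
by move=> x /XC [ab Cab abx]; exists (g ab) => //; exists ab.
Qed.

Definition translate (l : V) : V -> V := fun x => x + l.

Lemma lebesgue_outer_preimage_translate_le (l : V) (X : set V) :
  (lebesgue_outer R d (translate l @^-1` X) <= lebesgue_outer R d X)%E.
Proof.
apply: le_ereal_inf_tmp => _ [C [cC XC] <-].
pose g (ab : V * V) := (ab.1 - l, ab.2 - l).
rewrite -(@eq_esum _ _ C (fun ab => (box_volume (g ab))%:E)); last first.
  move=> ab _; congr (_%:E); apply: eq_bigr => i _; congr (Num.max 0 _).
  by rewrite /g /= !mxE; ring.
apply: lebesgue_outer_le_boxes => // x /XC [ab Cab abx]; exists ab => // i.
by have := abx i; rewrite /g /= !mxE lerBlDr ltrBrDr.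
Qed.

Lemma preimage_translateK (l : V) (X : set V) :
  translate (- l) @^-1` (translate l @^-1` X) = X.
Proof. by apply/seteqP; split => x; rewrite /translate /= subrK. Qed.

Lemma lebesgue_outer_preimage_translate (l : V) (X : set V) :
  lebesgue_outer R d (translate l @^-1` X) = lebesgue_outer R d X.
Proof.
apply/eqP; rewrite eq_le lebesgue_outer_preimage_translate_le /=.
rewrite -{1}(preimage_translateK l X).
exact: lebesgue_outer_preimage_translate_le.
Qed.

(** Splitting [Y] by the preimage of [X] is, after translation by [l], splitting the translate of
    [Y] by [X]. Invariance of the outer measure carries the Caratheodory criterion over. *)
Lemma measurable_preimage_translate (l : V) (X : set T) :
  measurable X -> measurable (translate l @^-1` X : set T).
Proof.
move=> mX; apply: le_caratheodory_measurable => Y.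
have {mX}: (lebesgue_outer R d).-caratheodory X by exact: mX.
move=> /(_ (translate (- l) @^-1` Y)) mXY.
rewrite -(preimage_translateK (- l) Y) opprK preimage_setC -!preimage_setI.
rewrite /OuterMeasure.sort /=.
rewrite !lebesgue_outer_preimage_translate.
by rewrite -(lebesgue_outer_preimage_translate (- l) Y) [leRHS]mXY lexx.
Qed.

Lemma measurable_translate (l : V) :
  measurable_fun setT (translate l : T -> T).
Proof. by move=> _ X mX; rewrite setTI; exact: measurable_preimage_translate. Qed.

(** Cutting each box of a cover at x_i = c gives half-open boxes again; they cover the two parts of
    the test set with the same total volume. *)
Lemma measurable_halfspace (i : 'I_d) (c : R) :
  measurable ([set x : V | x i 0 < c] : set T).
Proof.
apply: le_caratheodory_measurable => X.
rewrite /lebesgueRd; apply: le_ereal_inf_tmp => _ [C [cC XC] <-].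
pose g1 (ab : V * V) : V * V :=
  (ab.1, \col_j (if j == i then Num.min (ab.2 j 0) c else ab.2 j 0)).
pose g2 (ab : V * V) : V * V :=
  (\col_j (if j == i then Num.max (ab.1 j 0) c else ab.1 j 0), ab.2).
(* This includes cuts that miss the box and empty boxes: the clipping at 0 in [box_volume] makes a
   degenerate half count for nothing. *)
have vol ab : box_volume ab = box_volume (g1 ab) + box_volume (g2 ab).
  rewrite /box_volume (bigD1 i) //= [X in _ = X + _](bigD1 i) //=.
  rewrite [X in _ = _ + X](bigD1 i) //= !mxE eqxx.
  set P := \prod_(j < d | _) _.
  rewrite [X in _ = _ * X + _](_ : _ = P); last first.
    by apply: eq_bigr => j ji; rewrite !mxE (negPf ji).
  rewrite [X in _ = _ + _ * X](_ : _ = P); last first.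
    by apply: eq_bigr => j ji; rewrite !mxE (negPf ji).
  rewrite -mulrDl; congr (_ * _); rewrite /Num.max /Num.min.
  by repeat case: ifPn; lra.
rewrite [leRHS](_ : _ = \esum_(ab in C) (box_volume (g1 ab))%:E +
                        \esum_(ab in C) (box_volume (g2 ab))%:E)%E; last first.
  rewrite -esumD; [|by move=> *; exact: box_volume_ge0..].
  by apply: eq_esum => ab _; rewrite vol EFinD.
apply: leeD; apply: lebesgue_outer_le_boxes => // x -[/XC[ab Cab abx] xc];
    exists ab => // j; have := abx j; rewrite !mxE.
  by case: eqP => [->|//]; rewrite lt_min => /andP[-> ->].
case: eqP => [->|//]; rewrite ge_max => /andP[-> ->].
by rewrite andbT leNgt; apply/negP.
Qed.

Lemma measurable_coord (i : 'I_d) :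
  measurable_fun setT ((fun x : V => x i 0) : T -> R).
Proof.
move=> mD; apply: (measurability _ (RGenCInfty.measurableE R)) => //.
move=> /= _ [_ [c ->] <-]; rewrite setTI.
rewrite [X in measurable X](_ : _ = ~` [set x : V | x i 0 < c]).
  by apply: measurableC; exact: measurable_halfspace.
by apply/seteqP; split => x; rewrite /= in_itv /= andbT leNgt => /negP.
Qed.

Lemma measurable_dot (a : V) : measurable_fun setT (dot a : T -> R).
Proof.
apply: measurable_sum => i.
exact: measurableT_comp (@mulrl_measurable R setT (a i 0)) (measurable_coord i).
Qed.

Lemma measurable_box (ab : V * V) : measurable (box ab : set T).
Proof.
rewrite (_ : box ab = \bigcap_(i in [set: 'I_d])
    ([set x : V | x i 0 < ab.2 i 0] `&` ~` [set x : V | x i 0 < ab.1 i 0])).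
  apply: fin_bigcap_measurable => // i _; apply: measurableI.
    exact: measurable_halfspace.
  by apply: measurableC; exact: measurable_halfspace.
apply/seteqP; split => [x xab i _ /=|x xab i].
  by have /andP[ax bx] := xab i; split => //=; apply/negP; rewrite -leNgt.
by have [/= -> /negP] := xab i I; rewrite -leNgt => ->.
Qed.

End lebesgueRd_theory.

(** * Step functions on measure-preserving copies of one set *)

Section transported_pieces.
Context (R : realType) dd (T : measurableType dd).
Context (mu : {measure set T -> \bar R}).
Variables (n : nat) (tau sigma : 'I_n.+1 -> T -> T) (F Omega : set T).
Hypotheses (mtau : forall i, measurable_fun setT (tau i))
  (msigma : forall i, measurable_fun setT (sigma i))
  (tauK : forall i, cancel (tau i) (sigma i))
  (mutau : forall i A, measurable A -> mu (tau i @^-1` A) = mu A)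
  (mF : measurable F) (mOmega : measurable Omega)
  (muOmega : (mu Omega < +oo)%E)
  (FOmega : forall i, sigma i @^-1` F `<=` Omega).

Let preimage_tau i : tau i @^-1` (sigma i @^-1` F) = F.
Proof. by apply/seteqP; split => x; rewrite /= tauK. Qed.

Lemma measurable_piece i : measurable (sigma i @^-1` F).
Proof. by rewrite -[X in measurable X]setTI; exact: msigma. Qed.

Lemma bounded_measurable_integrable (A : set T) (g : T -> R) (B : R) :
  measurable A -> (mu A < +oo)%E -> measurable_fun setT g ->
  (forall x, `|g x| <= B) -> mu.-integrable A (EFin \o g).
Proof.
move=> mA muA mg gB; apply: measurable_bounded_integrable => //.
  exact: measurable_funTS.
exists B; split; first exact: num_real.
by move=> M BM x _; exact: le_trans (gB x) (ltW BM).
Qed.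

(* [sigma i] inverts [tau i], so [sigma i @^-1` F] is the image of [F] under
   [tau i]: each term is transported back to [F]. *)
Lemma Rintegral_sum_pieces (g : 'I_n.+1 -> T -> R) (B : R) :
  (forall i, measurable_fun setT (g i)) -> (forall i x, `|g i x| <= B) ->
  \int[mu]_(x in Omega) (\sum_(i < n.+1) \1_(sigma i @^-1` F) x * g i x) =
  \int[mu]_(y in F) (\sum_(i < n.+1) g i (tau i y)).
Proof.
move=> mg gB.
(* [F] has the measure of its piece of index 0, which lies in [Omega]. *)
have muF : (mu F < +oo)%E.
  rewrite -(preimage_tau ord0) mutau; last exact: measurable_piece.
  by apply: le_lt_trans muOmega; apply: le_measure (@FOmega ord0);
    rewrite inE//; exact: measurable_piece.
(* Integrability and additivity go through one induction, since splitting off a term requires the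
   tail to be integrable. *)
have sumint (A : set T) (h : 'I_n.+1 -> T -> R) (s : seq 'I_n.+1) : measurable A ->
    (forall i, mu.-integrable A (EFin \o h i)) ->
    mu.-integrable A (EFin \o (fun x => \sum_(i <- s) h i x)) /\
    \int[mu]_(x in A) (\sum_(i <- s) h i x) =
    \sum_(i <- s) \int[mu]_(x in A) h i x.
  move=> mA ih; elim: s => [|i s [IH1 IH2]].
    rewrite big_nil; under eq_Rintegral do rewrite big_nil.
    rewrite Rintegral_cst// mul0r; split => //.
    rewrite (_ : _ \o _ = cst 0%E); first exact: integrable0.
    by apply/funext => x /=; rewrite big_nil.
  rewrite big_cons; split.
    rewrite (_ : _ \o _ = (EFin \o h i) \+
        (EFin \o (fun x => (\sum_(j <- s) h j x)%R)))%E.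
      exact: integrableD.
    by apply/funext => x /=; rewrite big_cons.
  under eq_Rintegral do rewrite big_cons.
  by rewrite RintegralD// IH2.
rewrite (sumint _ _ _ mOmega _).2; last first.
  move=> i; apply: (@bounded_measurable_integrable _ _ B) => //.
    apply: measurable_funM => //.
    by apply/measurable_indicP; exact: measurable_piece.
  move=> x; rewrite normrM indicE; case: (_ \in _).
    by rewrite normr1 mul1r.
  by rewrite normr0 mul0r; exact: le_trans (gB i x).
rewrite (sumint _ (fun i y => g i (tau i y)) _ mF _).2; last first.
  move=> i; apply: (@bounded_measurable_integrable _ _ B) => //.
  exact: measurableT_comp.
apply: eq_bigr => i _.
rewrite -[in RHS](preimage_tau i) -Rintegral_measure_preserving //.
- rewrite -[in RHS](setIidr (@FOmega i)) Rintegral_mkcondr.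
  apply: eq_Rintegral => x _; rewrite patchE indicE.
  by case: (_ \in _); rewrite ?mul1r ?mul0r.
- exact: mutau.
- exact: measurable_piece.
- rewrite preimage_tau; apply: (@bounded_measurable_integrable _ _ B) => //.
    exact: measurableT_comp.
  by move=> x /=; exact: gB.
Qed.

(** Real-valued: a complex step function is handled as two of these, for its real and imaginary
    parts, hence the pairs [p], [q] below. *)
Definition step (p : 'I_n.+1 -> R) (x : T) : R :=
  \sum_(i < n.+1) \1_(sigma i @^-1` F) x * p i.

Lemma measurable_step p : measurable_fun setT (step p).
Proof.
apply: measurable_sum => i; apply: measurable_funM => //.
by apply/measurable_indicP; exact: measurable_piece.
Qed.

Lemma step_le p x : `|step p x| <= \sum_(i < n.+1) `|p i|.
Proof.
apply: le_trans (ler_norm_sum _ _ _) _; apply: ler_sum => i _.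
rewrite normrM indicE; case: (_ \in _); first by rewrite normr1 mul1r.
by rewrite normr0 mul0r.
Qed.

Lemma integral_step_lty p q :
  (\int[mu]_(x in Omega) (step p x ^+ 2 + step q x ^+ 2)%:E < +oo)%E.
Proof.
have mpq : measurable_fun setT (fun x => step p x ^+ 2 + step q x ^+ 2).
  by apply: measurable_funD; apply: measurable_funX; exact: measurable_step.
apply: integrable_lty => //.
apply: (@bounded_measurable_integrable _ _ ((\sum_(i < n.+1) `|p i|) ^+ 2 +
  (\sum_(i < n.+1) `|q i|) ^+ 2)) => // x.
rewrite ger0_norm ?addr_ge0 ?sqr_ge0//.
rewrite -(real_normK (num_real (step p x))).
rewrite -(real_normK (num_real (step q x))).
by apply: lerD; rewrite lerXn2r ?nnegrE ?normr_ge0 ?sumr_ge0// step_le.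
Qed.

(** On piece [i0] no other term survives, so the integrand is a positive constant there, on a set of
    measure [mu F]; elsewhere it is nonnegative. *)
Lemma integral_step_gt0 p q i0 : (0 < mu F)%E ->
  (forall i x, F (sigma i x) -> F (sigma i0 x) -> i = i0) ->
  0 < p i0 ^+ 2 + q i0 ^+ 2 ->
  (0 < \int[mu]_(x in Omega) (step p x ^+ 2 + step q x ^+ 2)%:E)%E.
Proof.
move=> muF disj pq0.
have mpq : measurable_fun setT (fun x => step p x ^+ 2 + step q x ^+ 2).
  by apply: measurable_funD; apply: measurable_funX; exact: measurable_step.
apply: (@lt_le_trans _ _ (\int[mu]_(x in sigma i0 @^-1` F)
    (step p x ^+ 2 + step q x ^+ 2)%:E)%E); last first.
  apply: ge0_subset_integral => //.
  - exact: measurable_piece.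
  - by apply/measurable_EFinP; exact: measurable_funTS.
  - by move=> x _; rewrite lee_fin addr_ge0// sqr_ge0.
have stepE r x : F (sigma i0 x) -> step r x = r i0.
  move=> Fx; rewrite /step (bigD1 i0)//= indicE mem_set// mul1r.
  rewrite big1 ?addr0// => i ii0.
  rewrite indicE memNset ?mul0r// => Fix.
  by move/eqP: ii0; apply; exact: (disj _ _ Fix Fx).
rewrite (eq_integral (cst (p i0 ^+ 2 + q i0 ^+ 2)%:E)); last first.
  by move=> x /set_mem Fx; rewrite !stepE.
rewrite integral_cst; last exact: measurable_piece.
rewrite mule_gt0 ?lte_fin//.
by rewrite -(mutau i0) ?preimage_tau//; exact: measurable_piece.
Qed.

End transported_pieces.

(** * Exponentials under translation by dual lattice vectors *)

Section exponentials.
Variables (R : realType) (d : nat).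
Local Notation V := 'cV[R]_d.

Lemma expiD (s t : R) : expi (s + t) = expi s * expi t.
Proof. by rewrite /expi cosD sinD; congr Complex; ring. Qed.

Lemma expi0 : expi (0 : R) = 1.
Proof. by rewrite /expi cos0 sin0. Qed.

Lemma expi_nat (m : nat) : expi (2 * pi * m%:R : R) = 1.
Proof.
elim: m => [|m IH]; first by rewrite mulr0 expi0.
rewrite -[m.+1%:R]natr1 mulrDr expiD IH mulr1 mul1r mulr_natl.
by rewrite /expi cos2pi sin2pi.
Qed.

Lemma expi_int (t : R) : t \is a Num.int -> expi (2 * pi * t) = 1.
Proof.
move=> /intrP[[m|m] ->]; first exact: expi_nat.
(* A negative integer is reduced to its opposite, whose exponential is already known to be 1. *)
rewrite NegzE mulrNz mulrN; apply: (mulIr (x := expi (2 * pi * m.+1%:R))).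
  by rewrite expi_nat unitr1.
by rewrite -expiD addNr expi0 expi_nat mulr1.
Qed.

Lemma dotDl (x y z : V) : dot (x + y) z = dot x z + dot y z.
Proof. by rewrite /dot -big_split; apply: eq_bigr => i _; rewrite mxE mulrDl. Qed.

Lemma dotDr (x y z : V) : dot x (y + z) = dot x y + dot x z.
Proof. by rewrite /dot -big_split; apply: eq_bigr => i _; rewrite mxE mulrDr. Qed.

(** The integer <h, l> drops out of the phase, so the factor depends on [j] only. This is why k
    linear equations control infinitely many exponentials. *)
Lemma exp_system_translate (k : nat) (a : 'I_k -> V) (h l x : V) (j : 'I_k) :
  dot h l \is a Num.int ->
  exp_system a (h, j) (x + l) =
  expi (2 * pi * dot (a j) l) * exp_system a (h, j) x.
Proof.
move=> /expi_int hl; rewrite /exp_system /= dotDr mulrDr expiD mulrC.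
by congr (_ * _); rewrite dotDl mulrDr expiD hl mulr1.
Qed.

End exponentials.

(** * Complex sums, a kernel vector, trigonometric measurability *)

Lemma Re_sum (R : realType) (I : Type) (s : seq I) (f : I -> R[i]) :
  complex.Re (\sum_(i <- s) f i) = \sum_(i <- s) complex.Re (f i).
Proof. by apply: (big_morph (@complex.Re R)) => // -[? ?] [? ?]. Qed.

Lemma Im_sum (R : realType) (I : Type) (s : seq I) (f : I -> R[i]) :
  complex.Im (\sum_(i <- s) f i) = \sum_(i <- s) complex.Im (f i).
Proof. by apply: (big_morph (@complex.Im R)) => // -[? ?] [? ?]. Qed.

(** A matrix with k + 1 rows and k columns has rank at most k, so its left kernel is nonzero. *)
Lemma exists_left_kernel (K : fieldType) (k : nat) (w : 'I_k.+1 -> 'I_k -> K) :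
  exists c : 'I_k.+1 -> K, (exists i, c i != 0) /\
    forall j, \sum_i c i * w i j = 0.
Proof.
pose A := \matrix_(i < k.+1, j < k) w i j.
have : kermx A != 0.
  rewrite -mxrank_eq0 mxrank_ker -lt0n subn_gt0 ltnS.
  exact: rank_leq_col.
move=> /rowV0Pn [v /sub_kermxP vA v0].
exists (fun i => v 0 i); split.
  by have /rV0Pn[i vi] := v0; exists i.
move=> j; have := congr1 (fun M : 'rV_k => M 0 j) vA.
rewrite !mxE => vAj; rewrite -[RHS]vAj.
by apply: eq_bigr => i _; rewrite !mxE.
Qed.

Lemma measurable_Mcos_Msin (R : realType) dd (T : measurableType dd)
    (t : T -> R) (p q : R) : measurable_fun setT t ->
  measurable_fun setT (fun x => p * cos (t x) + q * sin (t x)).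
Proof.
move=> mt; apply: measurable_funD; apply: measurable_funM => //.
  apply: measurableT_comp mt; apply: continuous_measurable_fun.
  exact: continuous_cos.
apply: measurableT_comp mt; apply: continuous_measurable_fun.
exact: continuous_sin.
Qed.

(** * Under a frame, a set with k + 1 disjoint translates in Omega is null *)

Section null_pieces.
Variables (R : realType) (d : nat) (H Omega : set 'cV[R]_d).
Local Notation V := 'cV[R]_d.
Local Notation T := (caratheodory_type (lebesgue_outer R d)).
Local Notation mu := (lebesgueRd R d).
Variables (k : nat) (a : 'I_k -> V) (l : 'I_k.+1 -> V) (F : set T).
Hypotheses (mOmega : measurable (Omega : set T)) (muOmega : (mu Omega < +oo)%E)
  (mF : measurable F) (lH : forall i, dual_lattice H (l i))
  (FOmega : forall i x, F x -> Omega (x + l i))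
  (disj : forall i j x y, F x -> F y -> x + l i = y + l j -> i = j).

Let tau (i : 'I_k.+1) : T -> T := translate (l i).
Let sigma (i : 'I_k.+1) : T -> T := translate (- l i).

(** The test function f = sum_i c_i 1_(F + l_i): the preimage of [F] under [sigma i] is F + l_i. *)
Let stepC (c : 'I_k.+1 -> R[i]) (x : V) : R[i] :=
  Complex (step sigma F (fun i => complex.Re (c i)) x)
          (step sigma F (fun i => complex.Im (c i)) x).

Let mtau i : measurable_fun setT (tau i).
Proof. exact: measurable_translate. Qed.

Let msigma i : measurable_fun setT (sigma i).
Proof. exact: measurable_translate. Qed.

Let tauK i : cancel (tau i) (sigma i).
Proof. by move=> x; exact: addrK. Qed.

Let mutau i (A : set T) : measurable A -> mu (tau i @^-1` A) = mu A.
Proof. by move=> _; exact: lebesgue_outer_preimage_translate. Qed.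

Let pieceOmega i : sigma i @^-1` F `<=` Omega.
Proof.
move=> x /= /(FOmega i); rewrite /sigma /translate subrK; exact.
Qed.

Let sqnorm_stepC c : sqnorm Omega (stepC c) =
  (\int[mu]_(x in (Omega : set T))
     (step sigma F (fun i => complex.Re (c i)) x ^+ 2 +
      step sigma F (fun i => complex.Im (c i)) x ^+ 2)%:E)%E.
Proof.
apply: eq_integral => x _; congr (_%:E).
by rewrite sqr_sqrtr// addr_ge0// sqr_ge0.
Qed.

Let square_integrable_stepC c : square_integrable Omega (stepC c).
Proof.
split.
- by apply: measurable_funTS; exact: measurable_step.
- by apply: measurable_funTS; exact: measurable_step.
- rewrite sqnorm_stepC; exact: integral_step_lty msigma mF mOmega muOmega _ _.
Qed.

(** Brings the integrand of the inner product to the shape expected by [Rintegral_sum_pieces]. *)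
Let Re_stepC_mul c x z : complex.Re (stepC c x * z) =
  \sum_(i < k.+1) \1_(sigma i @^-1` F) x * complex.Re (c i * z).
Proof.
case: z => u v; rewrite /stepC /step /= !mulr_suml -sumrB.
by apply: eq_bigr => i _; case: (c i) => p q /=; ring.
Qed.

Let Im_stepC_mul c x z : complex.Im (stepC c x * z) =
  \sum_(i < k.+1) \1_(sigma i @^-1` F) x * complex.Im (c i * z).
Proof.
case: z => u v; rewrite /stepC /step /= !mulr_suml -big_split /=.
by apply: eq_bigr => i _; case: (c i) => p q /=; ring.
Qed.

Let cexp_bound (c : R[i]) hj x :
  `|complex.Re (c * conjc (exp_system a hj x))| <=
    `|complex.Re c| + `|complex.Im c| /\
  `|complex.Im (c * conjc (exp_system a hj x))| <=
    `|complex.Re c| + `|complex.Im c|.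
Proof.
rewrite /exp_system; set t := 2 * pi * _; case: c => p q /=.
have cosle : `|cos t| <= 1 by rewrite ler_norml cos_geN1 cos_le1.
have sinle : `|sin t| <= 1 by rewrite ler_norml sin_geN1 sin_le1.
split; apply: le_trans (ler_normD _ _) _.
  by rewrite mulrN opprK !normrM lerD// ler_piMr.
by rewrite mulrN normrN !normrM addrC [leRHS]addrC lerD// ler_piMr.
Qed.

Let measurable_cexp (c : R[i]) hj :
  measurable_fun setT
    ((fun x => complex.Re (c * conjc (exp_system a hj x))) : T -> R) /\
  measurable_fun setT
    ((fun x => complex.Im (c * conjc (exp_system a hj x))) : T -> R).
Proof.
have mt : measurable_fun setT
    ((fun x => 2 * pi * dot (a hj.2 + hj.1) x) : T -> R).
  exact: measurableT_comp (@mulrl_measurable R setT (2 * pi)) (measurable_dot _).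
case: c => p q /=; split.
  rewrite (_ : (fun _ => _) = fun x : T =>
      p * cos (2 * pi * dot (a hj.2 + hj.1) x) +
      q * sin (2 * pi * dot (a hj.2 + hj.1) x)).
    exact: measurable_Mcos_Msin.
  by apply/funext => x; rewrite /= mulrN opprK.
rewrite (_ : (fun _ => _) = fun x : T =>
    q * cos (2 * pi * dot (a hj.2 + hj.1) x) +
    (- p) * sin (2 * pi * dot (a hj.2 + hj.1) x)).
  exact: measurable_Mcos_Msin.
by apply/funext => x; rewrite /= mulrN mulNr addrC.
Qed.

(** Transported back to [F], the integrand at y is the part, real or imaginary, of sum_i c_i
    conj(e(y + l_i)). By [exp_system_translate] this sum is conj(e(y)) times the sum assumed to be
    0, so it vanishes pointwise. *)
Let inner_stepC_eq0 c h j :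
  (forall i, dot h (l i) \is a Num.int) ->
  \sum_i c i * conjc (expi (2 * pi * dot (a j) (l i))) = 0 ->
  inner Omega (stepC c) (exp_system a (h, j)) = 0.
Proof.
move=> hl c0.
have orth (y : V) :
    \sum_i c i * conjc (exp_system a (h, j) (translate (l i) y)) = 0.
  under eq_bigr => i _ do rewrite exp_system_translate// rmorphM mulrA.
  by rewrite -mulr_suml c0 mul0r.
have bound : exists B, forall i (x : V),
    `|complex.Re (c i * conjc (exp_system a (h, j) x))| <= B /\
    `|complex.Im (c i * conjc (exp_system a (h, j) x))| <= B.
  exists (\sum_i (`|complex.Re (c i)| + `|complex.Im (c i)|)) => i x.
  have cle : `|complex.Re (c i)| + `|complex.Im (c i)| <=
      \sum_i (`|complex.Re (c i)| + `|complex.Im (c i)|).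
    by rewrite (bigD1 i)//= lerDl sumr_ge0// => i' _; rewrite addr_ge0.
  have [re im] := cexp_bound (c i) (h, j) x.
  by split; [exact: le_trans re cle|exact: le_trans im cle].
have {bound}[B bound] := bound.
rewrite /inner /cintegral; congr Complex.
  under eq_Rintegral do rewrite Re_stepC_mul.
  rewrite (Rintegral_sum_pieces mtau msigma tauK mutau mF mOmega muOmega
    pieceOmega (fun i => (measurable_cexp (c i) (h, j)).1)
    (fun i x => (bound i x).1)).
  under eq_Rintegral do rewrite -Re_sum orth.
  by rewrite /= Rintegral_cst// mul0r.
under eq_Rintegral do rewrite Im_stepC_mul.
rewrite (Rintegral_sum_pieces mtau msigma tauK mutau mF mOmega muOmega
  pieceOmega (fun i => (measurable_cexp (c i) (h, j)).2)
  (fun i x => (bound i x).2)).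
under eq_Rintegral do rewrite -Im_sum orth.
by rewrite /= Rintegral_cst// mul0r.
Qed.

Lemma exp_frame_null_pieces : exp_frame Omega H a -> mu F = 0%E.
Proof.
move=> [_ _ [A [B [A0 B0 frame]]]].
have [c [[i0 ci0] c0]] := exists_left_kernel
  (fun i j => conjc (expi (2 * pi * dot (a j) (l i)))).
apply/eqP; rewrite eq_le measure_ge0 andbT leNgt; apply/negP => muF.
(* Only the lower frame bound is kept. All coefficients of f vanish, so it would force [A] times the
   squared norm of f to be at most 0. *)
have /andP[+ _] := frame _ (square_integrable_stepC c).
rewrite esum1; last first.
  move=> [h j] [Hh _]; rewrite inner_stepC_eq0//.
    by rewrite Normc.normc0 expr0n.
  by move=> i; exact: lH.
apply/negP; rewrite -ltNge mule_gt0 ?lte_fin//.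
rewrite sqnorm_stepC.
apply: (integral_step_gt0 msigma tauK mutau mF mOmega pieceOmega (i0 := i0)) => //.
  move=> i x Fi Fi0; apply: (disj Fi Fi0).
  by rewrite /sigma /translate !subrK.
rewrite lt_neqAle addr_ge0 ?sqr_ge0// andbT eq_sym.
apply: contra ci0; case: (c i0) => p q /=.
by rewrite paddr_eq0 ?sqr_ge0// !sqrf_eq0 => /andP[/eqP-> /eqP->].
Qed.

End null_pieces.

(** * Dual lattices, counting lattice points, and separating them by a grid *)

Section lattices.
Variables (R : realType) (d : nat).
Local Notation V := 'cV[R]_d.

Lemma dotE (x y : V) : dot x y = (x^T *m y) 0 0.
Proof. by rewrite mxE; apply: eq_bigr => i _; rewrite mxE. Qed.

(** The inverse transpose of a basis matrix of [H] is a basis matrix of the dual. *)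
Lemma full_lattice_dual (H : set V) :
  full_lattice H -> full_lattice (dual_lattice H).
Proof.
move=> [M Munit ->]; exists (invmx M)^T; first by rewrite unitmx_tr unitmx_inv.
apply/seteqP; split => [l lM|_ [z _ <-] _ [w _ <-]].
  (* Pairing [l] with the j-th column of [M], a vector of the lattice, gives the j-th entry of M^T
     l. *)
  have lint (j : 'I_d) : exists m : int, (M^T *m l) j 0 = m%:~R.
    apply/intrP.
    have /lM : lattice_of M (M *m map_mx intr (delta_mx j 0 : 'cV[int]_d)).
      by exists (delta_mx j 0).
    rewrite dotE trmx_mul -mulmxA map_delta_mx trmx_delta -rowE.
    by rewrite mxE.
  have [z zE] := fin_all_exists lint.
  exists (\col_j z j) => //.
  rewrite (_ : map_mx _ _ = M^T *m l).
    by rewrite mulmxA -trmx_mul mulmxV// trmx1 mul1mx.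
  by apply/colP => j; rewrite zE !mxE.
rewrite dotE trmx_mul -mulmxA (mulmxA M^T) -trmx_mul mulVmx// trmx1 mul1mx.
rewrite mxE; apply: rpred_sum => i _; rewrite !mxE.
by apply: rpredM; apply: intr_int.
Qed.

(** The sum is a supremum over finite subsets, and on each of these it counts the v with w + v in
    [Omega]. If no k + 1 distinct such v exist, every finite count is at most k. *)
Lemma esum_indic_gt (Lambda Omega : set V) (w : V) (k : nat) :
  ~ (\esum_(v in Lambda) (\1_Omega (w + v) : R)%:E <= k%:R%:E)%E ->
  exists l : 'I_k.+1 -> V, injective l /\
    forall i, Lambda (l i) /\ Omega (w + l i).
Proof.
apply: contra_notP => nol.
apply: ge_ereal_sup => _ [X [finX XL] <-].
rewrite fsbig_finite//= sumEFin lee_fin.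
set s := (X in \sum_(v <- X) _).
have us : uniq s by exact: finmap.fset_uniq.
have -> : \sum_(v <- s) \1_Omega (w + v) =
    (size [seq v <- s | (w + v) \in Omega])%:R :> R.
  rewrite size_filter -sum1_count natr_sum big_mkcond /=.
  by rewrite [RHS]big_mkcond; apply: eq_bigr => v _; rewrite indicE; case: (_ \in _).
rewrite ler_nat leqNgt; apply/negP => ks; apply: nol.
set s' := [seq v <- s | _] in ks.
exists (fun i => nth 0 s' i); split.
  move=> i j /eqP; rewrite nth_uniq ?filter_uniq//.
  - by move=> /eqP/val_inj.
  - exact: leq_trans (ltn_ord i) ks.
  - exact: leq_trans (ltn_ord j) ks.
move=> i; have : nth 0 s' i \in s'.
  by apply: mem_nth; exact: leq_trans (ltn_ord i) ks.
rewrite mem_filter => /andP[/set_mem wO].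
by rewrite in_fset_set// => /set_mem/XL.
Qed.

(* Two points of one cell differ by less than [m.+1%:R^-1] in each coordinate;
   a piece inside such a cell therefore has disjoint translates along separated
   vectors, and no fundamental domain has to be measurable. *)
Definition grid_box (m : nat) (q : 'cV[int]_d) : set V :=
  box (\col_r ((q r 0)%:~R / m.+1%:R), \col_r ((q r 0 + 1)%:~R / m.+1%:R)).

Lemma grid_box_cover m (w : V) : exists q, grid_box m q w.
Proof.
exists (\col_r Num.floor (w r 0 * m.+1%:R)) => r /=.
rewrite !mxE ler_pdivrMr// ltr_pdivlMr//.
by rewrite floor_le_tmp floorD1_gt.
Qed.

Lemma grid_box_dist m q (x y : V) r : grid_box m q x -> grid_box m q y ->
  `|x r 0 - y r 0| < m.+1%:R^-1.
Proof.
move=> /(_ r) + /(_ r); rewrite /= !mxE intrD mulrDl mul1r.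
move: (_ / _) => u; move: (_^-1) => v /andP[? ?] /andP[? ?].
by rewrite ltr_norml; apply/andP; split; lra.
Qed.

(** Each pair of distinct indices has a coordinate with a nonzero gap; [m] is the largest of the
    integers bounding the inverses of these finitely many gaps. *)
Lemma injective_separated (n : nat) (l : 'I_n -> V) : injective l ->
  exists m : nat, forall i j, i != j ->
    exists r, m.+1%:R^-1 <= `|l i r 0 - l j r 0|.
Proof.
move=> linj.
have sep (p : 'I_n * 'I_n) : exists m : nat, p.1 != p.2 ->
    exists r, m.+1%:R^-1 <= `|l p.1 r 0 - l p.2 r 0|.
  have [->|pp] := eqVneq p.1 p.2; first by exists 0.
  have /eqP/colP/existsNP[r /eqP] : l p.1 != l p.2.
    by rewrite (inj_eq linj).
  rewrite -subr_eq0 -normr_gt0 => lr.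
  exists (Num.bound (`|l p.1 r 0 - l p.2 r 0|^-1)) => _; exists r.
  rewrite invf_ple ?posrE//; apply: ltW.
  apply: lt_trans (archi_boundP _) _; first by rewrite invr_ge0.
  by rewrite ltr_nat.
have [f fP] := fin_all_exists sep.
exists (\max_p f p) => i j ij.
have [r rP] := fP (i, j) ij; exists r; apply: le_trans rP.
rewrite lef_pV2 ?posrE// ler_nat ltnS.
exact: (leq_bigmax (F := f) (i, j)).
Qed.

End lattices.

(** * The almost everywhere bound from countably many null sets *)

Section subtiling.
Variables (R : realType) (d : nat) (H Omega : set 'cV[R]_d).
Local Notation V := 'cV[R]_d.
Local Notation T := (caratheodory_type (lebesgue_outer R d)).
Local Notation mu := (lebesgueRd R d).
Variables (k : nat) (a : 'I_k -> V).
Hypotheses (mOmega : measurable (Omega : set T)) (muOmega : (mu Omega < +oo)%E)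
  (frame : exp_frame Omega H a).

(** The conditions on [l] and [m] do not involve [w]; placed inside the set, they make it empty for
    bad parameters, so all parameters can be enumerated without selection. *)
Let crowded (l : 'I_k.+1 -> V) (m : nat) (q : 'cV[int]_d) : set V :=
  [set w | [/\ forall i, dual_lattice H (l i),
    forall i j, i != j -> exists r, m.+1%:R^-1 <= `|l i r 0 - l j r 0|,
    grid_box m q w & forall i, Omega (w + l i)]].

(** If x + l_i = y + l_j with i and j distinct, the gap between l_i and l_j equals that between y
    and x in every coordinate. This is too small within one grid cell, so the translates are
    disjoint and [exp_frame_null_pieces] applies. *)
Let crowded_negligible l m q : mu.-negligible (crowded l m q : set T).
Proof.
have [lH|nlH] := pselect (forall i, dual_lattice H (l i)); last first.
  apply: negligibleS (negligible_set0 _) => w [lH _ _ _].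
  exact: nlH.
have [lsep|nlsep] := pselect (forall i j, i != j ->
    exists r, m.+1%:R^-1 <= `|l i r 0 - l j r 0|); last first.
  apply: negligibleS (negligible_set0 _) => w [_ lsep _ _].
  exact: nlsep.
pose F : set T := grid_box m q `&`
  \bigcap_(i in [set: 'I_k.+1]) (translate (l i) @^-1` Omega).
have mF : measurable F.
  apply: measurableI; first exact: measurable_box.
  by apply: fin_bigcap_measurable => // i _; exact: measurable_preimage_translate.
exists F; split => //; last first.
  by move=> w [_ _ wq wO]; split => // i _; exact: wO.
apply: (exp_frame_null_pieces mOmega muOmega mF lH _ _ frame).
  by move=> i x [_ /(_ i I)].
move=> i j x y [xq _] [yq _] xy; apply/eqP; apply: contraT => /lsep [r].
rewrite leNgt => /negP; case.
have -> : l i r 0 - l j r 0 = y r 0 - x r 0.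
  have := congr1 (fun z : V => z r 0) xy; rewrite !mxE => xyr.
  by apply/eqP; rewrite subr_eq addrAC eq_sym subr_eq -xyr addrC.
exact: grid_box_dist yq xq.
Qed.

(** Each bad [w] lies in a crowded set. Writing the vectors l_i in integer coordinates with respect
    to [M] leaves countably many parameters, enumerated by [pickle]. *)
Lemma exp_frame_subtiles_ae (M : 'M[R]_d) :
  dual_lattice H = lattice_of M ->
  {ae mu, forall w : V, (\esum_(v in dual_lattice H)
    (\1_Omega (w + v) : R)%:E <= (k%:R)%:E)%E}.
Proof.
move=> HM.
pose vec (z : 'cV[int]_d) : V := M *m map_mx intr z.
pose E n : set T :=
  if (unpickle n : option ({ffun 'I_k.+1 -> 'cV[int]_d} * nat * 'cV[int]_d))
    is Some (z, m, q) then crowded (fun i => vec (z i)) m q else set0.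
apply: (@negligibleS _ _ _ _ (\bigcup_n E n)); last first.
  apply: negligible_bigcup => n; rewrite /E.
  case: unpickle => [[[z m] q]|]; first exact: crowded_negligible.
  exact: negligible_set0.
move=> w /= /esum_indic_gt [l [linj lP]].
have [m msep] := injective_separated linj.
have [q wq] := grid_box_cover m w.
have lz i : exists z, vec z = l i.
  by have [+ _] := lP i; rewrite HM => -[z _ <-]; exists z.
have [z zE] := fin_all_exists lz.
exists (pickle (finfun z, m, q)) => //; rewrite /E pickleK.
have -> : (fun i => vec (finfun z i)) = l.
  by apply/funext => i; rewrite ffunE zE.
by split => // i; have [] := lP i.
Qed.

End subtiling.

Theorem theorem4p4 (R : realType) (d : nat) (H : set 'cV[R]_d) (k : nat)
    (Omega : set 'cV[R]_d) :
  full_lattice H ->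
  (0 < k)%N ->
  Rd_measurable Omega ->
  (lebesgueRd R d Omega < +oo)%E ->
  (exists a : 'I_k -> 'cV[R]_d, exp_frame Omega H a) ->
  exists l : nat, (0 < l <= k)%N /\ subtiles l (dual_lattice H) Omega.

Proof.
move=> fullH k0 mOmega muOmega [a frame].
exists k; split; first by rewrite k0 leqnn.
split => //; first exact: full_lattice_dual.
move=> M _ HM.
(* The bound holds almost everywhere on the whole space, hence on the fundamental domain of any
   basis. *)
apply: negligibleS (exp_frame_subtiles_ae mOmega muOmega frame HM) => w + wle.
by apply => _.
Qed.
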